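(* Let $G$ be an Abelian group (written additively) and $\varphi$ a filter on $G$. Then $\varphi$ is a $PT$-filter if and only if $\bigcap\sum(\varphi^{*})=\{0\}$. Moreover, for each $PT$-filter $\varphi$ on $G$, the family $\sum(\varphi^{*})$ is a base of neighborhoods of $0$ for the paratopological group $P(G|\varphi)$.
   Context: All paratopological group topologies (topologies making addition jointly continuous) are assumed $T_1$. A filter $\varphi$ converges to $0$ in a topology if every neighborhood of $0$ belongs to $\varphi$. A filter $\varphi$ on $G$ is a $PT$-filter if there is a ($T_1$) paratopological group topology on $G$ in which $\varphi$ converges to $0$; in this case $P(G|\varphi)$ denotes $G$ endowed with the strongest (finest) paratopological group topology in which $\varphi$ converges to $0$. For $U\in\varphi$ put $U^{*}=U\cup\{0\}$, and $\varphi^{*}=\{U^{*}:U\in\varphi\}$. For a sequence $\{U_n\}_{n\in\omega}$ of non-empty subsets of $G$ put $\sum_{n\in\omega}U_n=\bigcup_{n\in\omega}(U_0+\cdots+U_n)$. $\sum(\varphi^{*})$ is the family of all sets $\sum_{n\in\omega}U_n$ with $U_n\in\varphi^{*}$ for every $n\in\omega$, and $\bigcap\sum(\varphi^{*})$ is the intersection of all members of this family. *)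

(* Defs.v *)
From mathcomp Require Import all_boot all_order all_algebra.
From mathcomp Require Import all_classical topology.

Set Implicit Arguments.
Unset Strict Implicit.
Unset Printing Implicit Defensive.

Import GRing.Theory.
Local Open Scope classical_set_scope.
Local Open Scope ring_scope.

(* As in the library's [sup_topology], a topology on the bare carrier of [G] is
   a term [t : Topological G]; [topologized t] is the corresponding topological
   space, whose carrier is convertible to [G]. *)
Definition topologized (G : zmodType) (t : Topological G) : topologicalType :=
  Topological.Pack t.

Definition is_paratopology (G : zmodType) (t : Topological G) : Prop :=
  continuous (fun x : topologized t * topologized t =>
    ((x.1 : G) + (x.2 : G) : topologized t))
  /\ accessible_space (topologized t).

Definition converges0 (G : zmodType) (phi : set_system G) (t : Topological G) :
  Prop := phi --> ((0 : G) : topologized t).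

Definition PT_filter (G : zmodType) (phi : set_system G) : Prop :=
  exists t : Topological G, is_paratopology t /\ converges0 phi t.

(* [topologized t] is P(G|phi); this determines the open sets uniquely. *)
Definition is_P (G : zmodType) (phi : set_system G) (t : Topological G) :
    Prop :=
  [/\ is_paratopology t, converges0 phi t &
      forall t' : Topological G, is_paratopology t' -> converges0 phi t' ->
        @open (topologized t') `<=` @open (topologized t)].

Definition star (G : zmodType) (phi : set_system G) : set_system G :=
  [set U `|` [set 0] | U in phi].

(* [partial_sum U n] is U_0 + ... + U_n, with [n.+1] summands. *)
Fixpoint partial_sum (G : zmodType) (U : nat -> set G) (n : nat) : set G :=
  if n is m.+1 then [set x + y | x in partial_sum U m & y in U m.+1] else U 0%N.

Definition set_series (G : zmodType) (U : nat -> set G) : set G :=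
  \bigcup_n partial_sum U n.

Definition series_family (G : zmodType) (B : set_system G) : set_system G :=
  [set set_series U | U in [set U : nat -> set G | forall n, B (U n)]].

(* The members of a base of neighborhoods are not required to be open. *)
Definition is_nbhs_base (T : topologicalType) (x : T) (B : set_system T) :
    Prop :=
  B `<=` nbhs x /\ forall N, nbhs x N -> exists2 S, B S & S `<=` N.

(* Main.v *)
From HB Require Import structures.
Require Import Defs.
From mathcomp Require Import all_boot all_order all_algebra.
From mathcomp Require Import all_classical topology.

Import GRing.Theory.
Local Open Scope classical_set_scope.
Local Open Scope ring_scope.

(** If [V_n] is contained in [U_(2n)] and in [U_(2n+1)], then pairing up the
    summands shows that the series [S'] of [V] satisfies [S' + S' <= S], where
    [S] is the series of [U].  Hence the translates of the sets
    [U_0 + U_1 + ...] are neighborhood bases of a topology with continuous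
    addition, which is T1 exactly when these sets meet only in [0].
    Conversely, in a topology with continuous addition in which [phi] converges
    to [0], every neighborhood [N] of [0] admits neighborhoods [N_n] of [0] with
    [N_0 + N_0 <= N] and [N_(n+1) + N_(n+1) <= N_n]; the [N_n] belong to
    [star phi] and their series lies in [N].  So the topology above is finer
    than all of these. *)

(** * Partial sums of a sequence of sets *)

Section SetSeries.
Context {G : zmodType}.
Implicit Types (U V N : nat -> set G) (A : set G).

Lemma partial_sum_subset {U V n} :
  (forall i, U i `<=` V i) -> partial_sum U n `<=` partial_sum V n.
Proof.
move=> UV; elim: n => [|n IHn] /=; first exact: UV.
by move=> _ [x Ux [y Uy <-]]; exists x; [exact: IHn|exists y => //; exact: UV].
Qed.

Lemma partial_sum_le {U m n} : (forall i, U i 0) -> (m <= n)%N ->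
  partial_sum U m `<=` partial_sum U n.
Proof.
move=> U0 /subnK <-; elim: (n - m)%N => // k IHk x Ux.
by exists x; [exact: IHk|exists 0; [exact: U0|rewrite addr0]].
Qed.

(** The [i]-th summands of [x] and [y] fill the slots [i.*2] and [i.*2.+1] of [U], so [n.+1] pairs
    use exactly the slots from [0] to [n.*2.+1]. *)
Lemma partial_sum_double {U V n x y} :
    (forall i, V i `<=` U i.*2 `&` U i.*2.+1) ->
  partial_sum V n x -> partial_sum V n y -> partial_sum U n.*2.+1 (x + y).
Proof.
move=> VU; elim: n => [|n IHn] in x y *.
  by move=> /VU[Ux _] /VU[_ Uy]; exists x => //; exists y.
move=> [x1 Vx1 [x2 /VU[Ux2 _] <-]] [y1 Vy1 [y2 /VU[_ Uy2] <-]].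
exists (x1 + y1 + x2); last by exists y2 => //; rewrite addrACA !addrA.
by exists (x1 + y1); [exact: IHn|exists x2].
Qed.

(** The extra term [y] makes the sum collapse from its last summand: if [b] is in [N n.+1], then
    [b + y] lies in [N n] and takes the place of [y] one index lower. *)
Lemma partial_sum_halving {N A n x y} :
    (forall a b, N 0%N a -> N 0%N b -> A (a + b)) ->
    (forall i a b, N i.+1 a -> N i.+1 b -> N i (a + b)) ->
  partial_sum N n x -> N n y -> A (x + y).
Proof.
move=> NA NN; elim: n => [|n IHn] in x y *; first exact: NA.
by move=> [a Na [b Nb <-]] Ny; rewrite -addrA; apply: IHn => //; exact: NN.
Qed.

End SetSeries.

(** * The series family as a filter base at zero *)

Section SeriesFamily.
Context {G : zmodType} (phi : set_system G) {phi_filter : Filter phi}.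

(** Upward closure of [phi] puts every [U] with [0] adjoined back into [phi]. *)
Lemma starE : star phi = [set U | phi U /\ U 0].
Proof.
apply/seteqP; split=> [_ [U phiU <-]|U [phiU U0]] /=.
  by split; [apply: filterS phiU; left|right].
by exists U => //; apply/setUidPl => _ ->.
Qed.

Lemma series_familyP (S : set G) : series_family (star phi) S <->
  exists U, [/\ forall n, phi (U n), forall n, U n 0 & S = set_series U].
Proof.
rewrite /series_family starE; split=> [[U phiU <-]|[U [phiU U0 ->]]].
  by exists U; split=> // n; case: (phiU n).
by exists U => // n; split.
Qed.

Lemma series_family0 {S : set G} : series_family (star phi) S -> S 0.
Proof. by move=> /series_familyP[U [_ U0 ->]]; exists 0%N => //; exact: U0. Qed.

Lemma series_family_filter {S : set G} : series_family (star phi) S -> phi S.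
Proof.
move=> /series_familyP[U [phiU _ ->]].
by apply: filterS (phiU 0%N) => x Ux; exists 0%N.
Qed.

Lemma series_familyT : series_family (star phi) setT.
Proof.
apply/series_familyP; exists (fun=> setT); split=> // [n|].
  exact: filterT.
by apply/seteqP; split=> // x _; exists 0%N.
Qed.

Lemma series_familyI {S T : set G} :
    series_family (star phi) S -> series_family (star phi) T ->
  exists2 W, series_family (star phi) W & W `<=` S `&` T.
Proof.
move=> /series_familyP[U [phiU U0 ->]] /series_familyP[V [phiV V0 ->]].
exists (set_series (fun n => U n `&` V n)).
  apply/series_familyP; exists (fun n => U n `&` V n); split=> // n.
  by apply: filterI.
by move=> x [n _ UVx]; split; exists n => //; apply: partial_sum_subset UVx => i;
  [exact: subIsetl|exact: subIsetr].
Qed.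

Lemma series_family_half {S : set G} : series_family (star phi) S ->
  exists2 T, series_family (star phi) T &
    forall x y, T x -> T y -> S (x + y).
Proof.
move=> /series_familyP[U [phiU U0 ->]].
pose V n := U n.*2 `&` U n.*2.+1; have V0 n : V n 0 by split.
exists (set_series V).
  by apply/series_familyP; exists V; split=> // n; apply: filterI.
(* As each [V i] contains [0], both partial sums can be padded to the common index [maxn m n]. *)
move=> x y [m _ Vx] [n _ Vy]; exists (maxn m n).*2.+1 => //.
apply: (partial_sum_double (V := V)) => [i||]; first exact: subset_refl.
  exact: partial_sum_le V0 (leq_maxl m n) _ Vx.
exact: partial_sum_le V0 (leq_maxr m n) _ Vy.
Qed.

End SeriesFamily.

(** An alias of [G] that records [phi_filter], so that the canonical topology on it can depend on
    [phi]. *)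
Definition series_space {G : zmodType} {phi : set_system G}
  (phi_filter : Filter phi) : Type := G.

(** * The topology generated by the translates of the series *)

Section SeriesTopology.
Context {G : zmodType} {phi : set_system G} (phi_filter : Filter phi).
Local Notation X := (series_space phi_filter).

Definition series_nbhs (x : X) : set_system X :=
  [set N | exists2 S, series_family (star phi) S &
             forall s, S s -> N ((x : G) + s)].

HB.instance Definition _ := Choice.copy X G.
HB.instance Definition _ := hasNbhs.Build X series_nbhs.

Let series_nbhs_proper (x : X) : ProperFilter (nbhs x).
Proof.
apply: Build_ProperFilter_ex => [N [S FS SN]|].
  by exists ((x : G) + 0); apply: SN; exact: series_family0 FS.
split=> [|M N [S FS SM] [T FT TN]|M N MN [S FS SM]].
- by exists setT => //; exact: series_familyT.
- have [W FW WST] := series_familyI phi FS FT.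
  by exists W => // s /WST[Ss Ts]; split; [exact: SM|exact: TN].
- by exists S => // s /SM; exact: MN.
Qed.

Let series_nbhs_singleton (x : X) (N : set X) : nbhs x N -> N x.
Proof.
move=> [S FS SN]; rewrite -(addr0 (x : G)).
by apply: SN; exact: series_family0 FS.
Qed.

Let series_nbhs_nbhs (x : X) (N : set X) : nbhs x N -> nbhs x (nbhs^~ N).
Proof.
move=> [S FS SN]; have [T FT TTS] := series_family_half phi FS.
exists T => // s Ts; exists T => // r Tr.
by rewrite -addrA; apply: SN; exact: TTS.
Qed.

HB.instance Definition _ := Nbhs_isNbhsTopological.Build X
  series_nbhs_proper series_nbhs_singleton series_nbhs_nbhs.

Definition series_topology : Topological G := Topological.class X.

Lemma nbhs_seriesE (x : G) : nbhs (x : topologized series_topology) =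
  [set N | exists2 S, series_family (star phi) S & forall s, S s -> N (x + s)].
Proof. by []. Qed.

Lemma series_topology_converges0 : converges0 phi series_topology.
Proof.
move=> N; rewrite nbhs_seriesE => -[S FS SN].
apply: filterS (series_family_filter phi FS) => s /SN.
by rewrite add0r.
Qed.

Lemma series_topology_paratopology :
    \bigcap_(S in series_family (star phi)) S = [set 0 : G] ->
  is_paratopology series_topology.
Proof.
move=> cap0; split.
  move=> [a b] N /=; rewrite nbhs_seriesE => -[S FS SN].
  have [T FT TTS] := series_family_half phi FS.
  exists ([set a + s | s in T], [set b + s | s in T]) => /=.
    by split; exists T => // s Ts; exists s.
  move=> [_ _] [/= [s Ts <-] [r Tr <-]].
  by rewrite addrACA; apply: SN; exact: TTS.
move=> x y /eqP xy.
(* Some series [S] misses the nonzero element [y - x], so the interior of [x + S] separates [x] from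
   [y]. *)
have : ~ (\bigcap_(S in series_family (star phi)) S) ((y : G) - (x : G)).
  by rewrite cap0 => /eqP; rewrite subr_eq0 => /eqP yx; apply: xy.
move=> /existsNP[S /not_implyP[FS nS]].
pose N : set (topologized series_topology) := [set z | S ((z : G) - (x : G))].
have Nx : nbhs x N.
  by exists S => // s Ss /=; rewrite /N /= addrAC subrr add0r.
exists N°; split.
- exact: open_interior.
- by apply/mem_set; exact: Nx.
- by apply/mem_set => /interior_subset /=.
Qed.

End SeriesTopology.

(** * Comparison with an arbitrary paratopology in which [phi] converges to zero *)

Section Paratopology.
Context {G : zmodType} {phi : set_system G}.

Lemma paratopology_nbhsD {t : Topological G} (x y : G) (N : set G) :
    is_paratopology t -> nbhs (x + y : topologized t) N ->
  exists A B, [/\ nbhs (x : topologized t) A, nbhs (y : topologized t) B &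
    forall a b, A a -> B b -> N (a + b)].
Proof.
move=> [cD _] /(cD (x, y))[[A B] /= [Ax By] ABN].
by exists A, B; split=> // a b Aa Bb; apply: (ABN (a, b)).
Qed.

Lemma paratopology_series {t : Topological G} (N : set G) : Filter phi ->
    is_paratopology t -> converges0 phi t -> nbhs (0 : topologized t) N ->
  exists2 S, series_family (star phi) S & S `<=` N.
Proof.
move=> phi_filter tP phi0 N0.
have /choice[h hP] (M : set G) : exists H : set G,
    nbhs (0 : topologized t) M -> nbhs (0 : topologized t) H /\
      forall a b, H a -> H b -> M (a + b).
  (* For choice, [h] must be total on sets; off the neighborhoods of [0] its value [M] is a
     dummy. *)
  have [M0|nM] := pselect (nbhs (0 : topologized t) M); last by exists M.
  have [|A [B [A0 B0 ABM]]] := @paratopology_nbhsD t 0 0 M tP.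
    by rewrite addr0.
  exists (A `&` B) => _; split=> [|a b [Aa _] [_ Bb]]; last exact: ABM.
  exact: filterI.
(* Starting at [h N] rather than [N] leaves room for the extra summand: already [M 0 + M 0] lies in
   [N]. *)
pose M n := iter n.+1 h N.
have M0 n : nbhs (0 : topologized t) (M n).
  by elim: n => [|n IHn]; [case: (hP N N0)|case: (hP _ IHn)].
exists (set_series M).
  apply/series_familyP; exists M; split=> // n; first exact: phi0.
  exact: nbhs_singleton (M0 n).
(* The extra term is [0], which belongs to [M n]. *)
move=> x [n _ Mx]; rewrite -[x]addr0; apply: (partial_sum_halving (N := M) (n := n)) => //.
- by case: (hP N N0).
- by move=> i; case: (hP _ (M0 i)).
- exact: nbhs_singleton (M0 n).
Qed.

Lemma paratopology_open_series {t : Topological G} (phi_filter : Filter phi) :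
    is_paratopology t -> converges0 phi t ->
  @open (topologized t) `<=` @open (topologized (series_topology phi_filter)).
Proof.
move=> tP phi0 O; rewrite !openE => Oopen x Ox.
(* Continuity of addition at [(x, 0)] reduces openness at [x] to neighborhoods of [0]. *)
have Nx : nbhs (0 : topologized t) [set z | O (x + z)].
  have [|A [B [Ax B0 ABO]]] := @paratopology_nbhsD t x 0 O tP.
    by rewrite addr0; exact: Oopen.
  by apply: filterS B0 => b; apply: ABO; exact: nbhs_singleton Ax.
by have [S FS SO] := paratopology_series _ phi_filter tP phi0 Nx; exists S.
Qed.

Lemma paratopology_bigcap_series {t : Topological G} : Filter phi ->
    is_paratopology t -> converges0 phi t ->
  \bigcap_(S in series_family (star phi)) S = [set 0 : G].
Proof.
move=> phi_filter tP phi0; apply/seteqP; split=> [x capx|_ ->].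
  apply: contrapT => /= x0; have [_ t1] := tP.
  have [|A [Aopen /set_mem A0 /set_mem nAx]] :=
    t1 (0 : topologized t) (x : topologized t).
    by apply/eqP => /esym.
  have [|S FS SA] := paratopology_series A phi_filter tP phi0.
    exact: open_nbhs_nbhs.
  by apply: nAx; apply: SA; exact: capx.
by move=> S /series_family0.
Qed.

End Paratopology.

Lemma nbhs_open_subset (T : Type) (t t' : Topological T) (x : T) :
    @open (Topological.Pack t) `<=` @open (Topological.Pack t') ->
  nbhs (x : Topological.Pack t) `<=` nbhs (x : Topological.Pack t').
Proof.
move=> tt' N; rewrite (@nbhsE (Topological.Pack t)).
rewrite (@nbhsE (Topological.Pack t')) => -[O [Oopen Ox] ON].
by exists O => //; split=> //; exact: tt'.
Qed.

Theorem theorem5p6 (G : zmodType) (phi : set_system G)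
    (phi_filter : ProperFilter phi) :
  (PT_filter phi <->
     \bigcap_(S in series_family (star phi)) S = [set 0 : G])
  /\ (PT_filter phi ->
       (exists t : Topological G, is_P phi t)
       /\ (forall t : Topological G, is_P phi t ->
             is_nbhs_base ((0 : G) : topologized t) (series_family (star phi)))).
Proof.
have phi_filter' : Filter phi by exact: _.
have PT_cap : PT_filter phi ->
    \bigcap_(S in series_family (star phi)) S = [set 0 : G].
  by move=> [t [tP phi0]]; exact: paratopology_bigcap_series tP phi0.
pose t0 := series_topology phi_filter'.
have t0_conv : converges0 phi t0 by exact: series_topology_converges0.
split; first split=> // cap0.
  by exists t0; split=> //; exact: series_topology_paratopology.
move=> /PT_cap cap0.
have t0P : is_paratopology t0 by exact: series_topology_paratopology.
split.
  by exists t0; split=> // t tP phi0; exact: paratopology_open_series.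
move=> t [tP phi0 t_finest]; split=> [S FS|N N0].
  (* Being finest, [t] refines [t0], in which every series is a neighborhood of [0]. *)
  apply: (@nbhs_open_subset _ t0 t 0); first exact: t_finest.
  by rewrite nbhs_seriesE; exists S => // s; rewrite add0r.
exact: paratopology_series tP phi0 N0.
Qed.
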